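(* Let $T$ be a tree with vertex set $\{v_1,\ldots,v_n\}$ and let $T^e$ be an arbitrary orientation of $T$. Let $D$ be the following orientation of $C_4\times T$: take four copies $T_1,T_2,T_3,T_4$ of $T$, with vertices $v_j^{(k)}$ ($1\le j\le n$, $1\le k\le 4$) corresponding to $v_j$; orient $T_1$ and $T_4$ as $T^e$ and orient $T_2$ and $T_3$ as the converse of $T^e$ (every arc reversed); and for each $j$ add the arcs $v_j^{(1)}\to v_j^{(2)}$, $v_j^{(1)}\to v_j^{(3)}$, $v_j^{(2)}\to v_j^{(4)}$, $v_j^{(4)}\to v_j^{(3)}$. (The underlying graph is $C_4\times T$, with the copies arranged in the 4-cycle $T_1,T_2,T_4,T_3$.) Then $D$ is a Pfaffian orientation of $C_4\times T$.
   Context: All graphs are finite and simple. $C_4$ is the cycle with 4 vertices and $G\times H$ is the Cartesian product of graphs. A cycle $C$ of a graph $G$ is nice if $G-C$ (the subgraph induced by the vertices not on $C$) has a perfect matching. If $D$ is an orientation of $G$ and $C$ is a cycle of even length, $C$ is oddly oriented in $D$ if, for either direction of traversal of $C$, an odd number of edges of $C$ are directed in $D$ along that direction. An orientation $D$ of $G$ is a Pfaffian orientation if every nice cycle of even length of $G$ is oddly oriented in $D$. *)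

(* Defs.v *)
(* A finite simple graph is a symmetric irreflexive [e : rel V]
   on a [V : finType]. *)
From mathcomp Require Import all_boot.

Set Implicit Arguments.
Unset Strict Implicit.
Unset Printing Implicit Defensive.

Definition simple_graph (V : finType) (e : rel V) : Prop :=
  symmetric e /\ irreflexive e.

(* A cycle is a traversal: a cyclic sequence of distinct vertices, with a base
   point and a direction. *)
Definition is_cycle (V : finType) (e : rel V) (c : seq V) : bool :=
  (2 < size c) && ucycleb e c.

Definition is_tree (V : finType) (e : rel V) : Prop :=
  [/\ simple_graph e,
      0 < #|V|,
      forall x y : V, connect e x y
    & forall c : seq V, ~~ is_cycle e c].

(* [M] is a perfect matching of the subgraph induced by [A]. *)
Definition perfect_matching_on (V : finType) (e : rel V) (A : {set V})
    (M : {set {set V}}) : Prop :=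
  partition M A /\
  forall B : {set V}, B \in M -> exists x y : V, e x y /\ B = [set x; y].

Definition nice (V : finType) (e : rel V) (c : seq V) : Prop :=
  is_cycle e c /\
  exists M : {set {set V}}, perfect_matching_on e (~: [set x in c]) M.

(* [d x y] means that there is an arc from [x] to [y]. *)
Definition is_orientation (V : finType) (e d : rel V) : Prop :=
  (forall x y : V, e x y = d x y || d y x) /\
  (forall x y : V, d x y -> ~~ d y x).

Definition forward_arcs (V : finType) (d : rel V) (c : seq V) : nat :=
  count (fun x => d x (next c x)) c.

Definition oddly_oriented (V : finType) (d : rel V) (c : seq V) : bool :=
  odd (forward_arcs d c) && odd (forward_arcs d (rev c)).

Definition pfaffian_orientation (V : finType) (e d : rel V) : Prop :=
  is_orientation e d /\
  forall c : seq V, nice e c -> ~~ odd (size c) -> oddly_oriented d c.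

Definition cartesian (V W : finType) (e : rel V) (f : rel W) : rel (V * W) :=
  fun x y => ((x.1 == y.1) && f x.2 y.2) || ((x.2 == y.2) && e x.1 y.1).

(* The cycle graph on n vertices, meaningful for n >= 3. *)
Definition cycle_graph (n : nat) : rel 'I_n :=
  fun i j => (j == ordS i) || (i == ordS j).

(* Positions of the four copies along the cycle: T1, T2, T4, T3, in this
   order; the names are the copy numbers, not the positions. *)
Definition T1 : 'I_4 := @Ordinal 4 0 isT.
Definition T2 : 'I_4 := @Ordinal 4 1 isT.
Definition T4 : 'I_4 := @Ordinal 4 2 isT.
Definition T3 : 'I_4 := @Ordinal 4 3 isT.

Definition C4_arc : rel 'I_4 :=
  fun k l => (k, l) \in [:: (T1, T2); (T1, T3); (T2, T4); (T4, T3)].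

(* The vertex [(k, v)] is the vertex corresponding to [v] in the copy [k]. *)
Definition C4_tree_orientation (V : finType) (te : rel V) : rel ('I_4 * V) :=
  fun x y =>
    if x.1 == y.1 then
      if x.1 \in [:: T1; T4] then te x.2 y.2 else te y.2 x.2
    else (x.2 == y.2) && C4_arc x.1 y.1.

(* Main.v *)
Require Import Defs.
From mathcomp Require Import all_boot all_fingroup.

(* In a bipartite graph, an orientation is Pfaffian as soon as all perfect
   matchings have the same sign in the expansion of the determinant of the
   signed biadjacency matrix: a nice cycle of length 2k gives two matchings
   that differ by a k-cycle, and comparing their signs shows that the cycle is
   oddly oriented.  Exchanging the two pairs of opposite edges of an oddly
   oriented square preserves the sign.  Both sides of a tree edge uv have as
   many vertices of either colour, so a matching containing one edge over uv
   contains two whose positions in C_4 are adjacent; a flip then moves both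
   into the fibres over u and v.  Once all edges lie in the fibres, flipping
   fibres leads to one fixed matching. *)

Set Implicit Arguments.
Unset Strict Implicit.
Unset Printing Implicit Defensive.

(** * Edge cuts and two-colourings of acyclic graphs *)

Section AcyclicGraphs.

Variable V : finType.

(** [A] consists of the vertices reachable from [u] once the edge [uv] is deleted. A path from [u]
    to [v] that avoids this edge would close up with it to a cycle. *)
Lemma acyclic_edge_cut (t : rel V) u v :
    simple_graph t -> (forall c, ~~ is_cycle t c) -> t u v ->
  exists A : {set V}, [/\ u \in A, v \notin A
    & forall x y, t x y -> x \in A -> y \notin A -> x = u /\ y = v].
Proof.
move=> [tC tI] acyc tuv.
pose t' := [rel x y | t x y && ~~ (((x == u) && (y == v)) || ((x == v) && (y == u)))].
have vA : ~~ connect t' u v.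
  apply/negP => /connectP [p0 pp0 lp0]; move: lp0.
  case/shortenP: pp0 => p t'p Up _ Dv.
  apply/negP: (acyc (u :: p)); rewrite negbK /is_cycle /ucycleb Up andbT.
  have tp : path t u p by apply: sub_path t'p => x y /= /andP[].
  rewrite /= rcons_path tp -Dv tC tuv /=.
  (* Closing the path gives at least three vertices: an empty path would make [uv] a loop, and a
     single step would be the deleted edge. *)
  case: p t'p Dv {tp Up} => [|a [|b p]] //=.
  - by move=> _ Dv; rewrite -Dv tI in tuv.
  - by move=> /andP[/andP[_ /norP[]]] + _ _ Dv; rewrite Dv !eqxx.
exists [set x | connect t' u x]; split; rewrite ?inE ?connect0 //.
move=> x y txy; rewrite !inE => ux uy.
have : ~~ t' x y.
  by apply: (contraNN _ uy) => t'xy; apply: (connect_trans ux); exact: connect1.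
rewrite /= txy negbK => /orP[/andP[/eqP-> /eqP->] // | /andP[/eqP Dx _]].
by rewrite Dx (negPf vA) in ux.
Qed.

(** Induction on the number of arcs of [t]: delete the edge across a cut, colour the rest, and
    exchange the colours on one side if the ends of the deleted edge clash. *)
Lemma acyclic_two_colouring (t : rel V) :
    simple_graph t -> (forall c, ~~ is_cycle t c) ->
  exists d : V -> bool, forall x y, t x y -> d y = ~~ d x.
Proof.
have [n] := ubnP #|[set p | t p.1 p.2]|.
elim: n t => // n IHn t /ltnSE-le_n st acyc; have [tC tI] := st.
have [/existsP[[u v] /= tuv] | not] := boolP [exists p, t p.1 p.2]; last first.
  exists (fun=> false) => x y txy.
  by case/existsP: not; exists (x, y).
have [A [uA vA cutA]] := acyclic_edge_cut st acyc tuv.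
pose t' := [rel x y | t x y && ((x \in A) == (y \in A))].
have [|||d dP] := IHn t'.
- apply: leq_trans le_n; apply/proper_card/properP; split.
    by apply/subsetP => p; rewrite !inE => /andP[].
  by exists (u, v); rewrite !inE //= uA (negPf vA) andbF.
- by split=> [x y|x] /=; rewrite ?tI // tC eq_sym.
- move=> c; move: (acyc c); apply: contra; rewrite /is_cycle /ucycleb.
  case/and3P=> -> cc ->; rewrite andbT /=.
  by apply: sub_cycle cc => x y /andP[].
pose f := (d u == d v).
exists (fun x => d x (+) (f && (x \in A))) => x y txy.
have [eqA | neqA] := eqVneq (x \in A) (y \in A).
  by rewrite (dP x y) /= ?txy ?eqA ?eqxx // addNb.
have [[Dx Dy] | [Dy Dx]] : (x = u /\ y = v) \/ (y = u /\ x = v).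
- case: (boolP (x \in A)) neqA => xA; case: (boolP (y \in A)) => // yA _.
    by left; apply: cutA.
  by right; apply: cutA; rewrite // tC.
- by rewrite Dx Dy uA (negPf vA) /f; case: (d u); case: (d v).
- by rewrite Dx Dy uA (negPf vA) /f; case: (d u); case: (d v).
Qed.

End AcyclicGraphs.

(** * The successor map of a cyclic sequence as a permutation *)

Section NextPermutation.

Lemma next_notin (T : eqType) (s : seq T) z : z \notin s -> next s z = z.
Proof. by rewrite next_nth => /negPf->. Qed.

Lemma prev_notin (T : eqType) (s : seq T) z : z \notin s -> prev s z = z.
Proof. by rewrite prev_nth => /negPf->. Qed.

(** Inserting [x] before [y] redirects to [x] what pointed to [y], and sends [x], fixed until then,
    to [y]: a composition with one transposition. *)
Lemma next_cons (T : finType) (x y : T) (s : seq T) z :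
    uniq [:: x, y & s] -> next [:: x, y & s] z = tperm x y (next (y :: s) z).
Proof.
rewrite [uniq _]/= inE negb_or -andbA => /and4P[xy xs ys _].
(* Here [a] is the current vertex of the walk along [s]; the implication records that [y] can only
   be met at its start. *)
have next_at_tperm a : z != x -> (z == y) ==> (y == a) ->
    next_at z x a s = tperm x y (next_at z y a s).
  move=> zx.
  have zyN b : z != b -> (z == y) ==> (y == b) -> z != y.
    by move=> zb; apply: contraTneq => Dz; rewrite -Dz eqxx (negPf zb).
  elim: s xs ys a => [|b s IHs] /= xs ys a zya.
    case: eqP => [_|/eqP/zyN/(_ zya) zy]; first by rewrite tpermR.
    by rewrite tpermD // eq_sym.
  move: xs ys; rewrite !inE !negb_or => /andP[xb xs] /andP[yb ys].
  case: eqP => [_|/eqP/zyN/(_ zya) zy]; first by rewrite tpermD.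
  by rewrite IHs // (negPf zy).
have [->|zx] := eqVneq z x; last first.
  by rewrite /= (negPf zx) next_at_tperm // eqxx implybT.
by rewrite (@next_notin _ (y :: s)) ?inE ?negb_or ?xy //= eqxx tpermL.
Qed.

(* [p] is a single cycle through the [k.+1] vertices of [c] outside [col]. *)
Lemma odd_perm_two_steps (T : finType) (col : pred T) k (c : seq T) :
    size c = k.*2.+2 -> uniq c -> path.cycle (fun x y => col y == ~~ col x) c ->
    ~~ head true (map col c) ->
  exists2 p : {perm T},
    forall z, p z = if col z then z else next c (next c z) & odd_perm p = odd k.
Proof.
elim: k c => [|k IHk] [|x [|y c']] //= [szc].
  case: c' szc => //= _; rewrite !andbT inE => xy _ _.
  exists 1%g; last by rewrite odd_perm1.
  move=> z; rewrite perm1; case: ifP => // _.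
  have nE w : next [:: x; y] w = tperm x y w.
    by rewrite next_cons /= ?inE ?xy //; case: eqP => [->|].
  by rewrite -[RHS]/(next [:: x; y] (next [:: x; y] z)) !nE tpermK.
case: c' szc => [|x' s] //= szc.
set c' := x' :: s => /and3P[xyc' yc' Uc'] /and3P[/eqP cy /eqP cx'].
rewrite rcons_path => /andP[ps clast] cx.
have cc' : path.cycle (fun x y => col y == ~~ col x) c'.
  by rewrite /= rcons_path ps /= cx' cy negbK.
have [||p pP odd_p] := IHk c' _ Uc' cc'; first by case: szc => <-.
  by rewrite /= cx' cy negbK.
have nE z : next [:: x, y & c'] z = tperm x y (tperm y x' (next c' z)).
  by rewrite !next_cons //= ?yc' ?xyc'.
have [xy xc'] : x != y /\ x \notin c' by apply/andP; rewrite -negb_or -in_cons.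
have xx' : x != x' by move: xc'; rewrite inE negb_or => /andP[].
have yx' : y != x' by move: yc'; rewrite inE negb_or => /andP[].
(* The vertex sent to [x'] by [p] now goes to [x], and [x] goes to [x']: the cycle grows by one
   vertex and its parity changes. *)
exists (p * tperm x x')%g; last by rewrite odd_permM odd_p odd_tperm xx' addbT.
move=> z; rewrite permM pP; case: ifP => cz.
  rewrite tpermD //; apply/eqP => Dz; move: cz;
    by rewrite -Dz ?cx' ?cy ?negbK (negPf cx).
rewrite -[RHS]/(next [:: x, y & c'] (next [:: x, y & c'] z)) !nE.
have [zc' | zc'] := boolP (z \in c'); last first.
  rewrite !(next_notin zc'); have [<-|xz] := eqVneq x z.
    rewrite tpermL [tperm y x' x]tpermD 1?eq_sym // tpermL (next_notin yc') tpermL.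
    by rewrite tpermD.
  have yz : y != z by apply: contraFneq cz => <-; rewrite cy cx.
  have x'z : x' != z by apply: contraNneq zc' => <-; rewrite mem_head.
  rewrite (tpermD xz x'z) (tpermD yz x'z) (tpermD xz yz) (next_notin zc').
  by rewrite (tpermD yz x'z) (tpermD xz yz).
have next_col w : w \in c' -> col (next c' w) = ~~ col w.
  by move/(next_cycle cc')/eqP.
set w := next c' z; have wc : w \in c' by rewrite mem_next.
have cw : col w by rewrite next_col // cz.
have xw : x != w by apply: contraTneq cw => <-.
have yw : y != w by apply: contraNneq yc' => ->.
have x'w : x' != w by apply: contraTneq cw => <-; rewrite cx' cy negbK.
rewrite (tpermD yw x'w) (tpermD xw yw).
have yu : y != next c' w by apply: contraNneq yc' => ->; rewrite mem_next.
have xu : x != next c' w by apply: contraNneq xc' => ->; rewrite mem_next.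
have [<-|x'u] := eqVneq x' (next c' w); first by rewrite !tpermR.
by rewrite !tpermD.
Qed.

End NextPermutation.

(** * Signs of perfect matchings in a bipartite graph *)

Section BipartiteMatchings.

Variables (V : finType) (e d : rel V) (col : pred V).
Hypothesis eC : symmetric e.
Hypothesis ecol : forall x y, e x y -> col y = ~~ col x.
Hypothesis ed : is_orientation e d.

Definition matching (m : V -> V) : Prop :=
  involutive m /\ forall x, e x (m x).

(** Call the vertices with [col] false black; they index the rows. With entry -1 for an arc leaving
    its black end and 1 for the other direction, this is the exponent of -1 in the product of the
    entries chosen by [m]. *)
Definition arc_parity (m : V -> V) : bool :=
  \big[addb/false]_(x | ~~ col x) d x (m x).

(* [m] and [m'] contribute with the same sign to the determinant of the signed
   biadjacency matrix of [d]. *)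
Definition same_sign (m m' : V -> V) : Prop :=
  exists2 p : {perm V}, forall z, p z = if col z then z else m' (m z)
    & odd_perm p = arc_parity m (+) arc_parity m'.

Lemma orientationN x y : e x y -> d y x = ~~ d x y.
Proof.
case: ed => eE dN exy; move: (exy); rewrite eE.
have [/dN/negPf-> | _] := boolP (d x y); first by [].
by move=> /= ->.
Qed.

Lemma matching_col m z : matching m -> col (m z) = ~~ col z.
Proof. by case=> _ em; apply: ecol. Qed.

Lemma same_sign_trans m1 m2 m3 :
  matching m1 -> matching m2 ->
  same_sign m1 m2 -> same_sign m2 m3 -> same_sign m1 m3.
Proof.
move=> M1 M2 [p pE podd] [q qE qodd]; exists (p * q)%g => [z|].
  rewrite permM pE; case cz: (col z); first by rewrite qE cz.
  by rewrite qE (matching_col _ M2) (matching_col _ M1) cz /= (proj1 M2).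
by rewrite odd_permM podd qodd addbA addbK.
Qed.

Lemma same_sign_sym m1 m2 :
  matching m1 -> matching m2 -> same_sign m1 m2 -> same_sign m2 m1.
Proof.
move=> M1 M2 [p pE podd]; exists p^-1%g; last by rewrite odd_permV podd addbC.
move=> z; apply: (@perm_inj _ p); rewrite permKV pE; case cz: (col z).
  by rewrite cz.
by rewrite (matching_col _ M1) (matching_col _ M2) cz /= (proj1 M1) (proj1 M2).
Qed.

Lemma eq_same_sign m1 m2 : matching m1 -> m1 =1 m2 -> same_sign m1 m2.
Proof.
move=> M1 E; exists 1%g => [z|].
  by rewrite perm1 -E (proj1 M1) if_same.
rewrite odd_perm1 /arc_parity -big_split /= big1 // => x _.
by rewrite E addbb.
Qed.

(** The last hypothesis says that the square [x y x' y'] is oddly oriented: reversing two of its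
    four steps negates two terms, which keeps the parity. Hence the flip changes [arc_parity], which
    the odd transposition of [x] and [x'] makes up for. *)
Lemma matching_flip m x y x' y' :
    matching m -> ~~ col x -> x != x' -> m x = y -> m x' = y' ->
    e x y' -> e x' y ->
    d x y (+) d x' y' (+) (d x y' (+) d x' y) ->
  exists m', [/\ matching m', same_sign m m',
    [/\ m' x = y', m' y = x', m' x' = y & m' y' = x]
    & forall z, z \notin [:: x; y; x'; y'] -> m' z = m z].
Proof.
move=> Mm cx xx' mx mx' exy' ex'y odd_sq; have [mK em] := Mm.
have cy' : col y' by rewrite (ecol exy').
have cx' : ~~ col x' by rewrite -(ecol ex'y) -mx (matching_col _ Mm).
have cy : col y by rewrite (ecol ex'y).
have neq u v : ~~ col u -> col v -> u != v by move=> cu; apply: contraTneq => <-.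
have yy' : y != y' by apply: contraNneq xx' => Dy; rewrite -(mK x) -(mK x') mx mx' Dy.
pose t := tperm y y'; pose m' z := t (m (t z)).
have tx z : ~~ col z -> t z = z by move=> cz; rewrite tpermD // eq_sym neq.
have ty : t y = y' by apply: tpermL.
have ty' : t y' = y by apply: tpermR.
have m'x : m' x = y' by rewrite /m' (tx x) // mx ty.
have m'x' : m' x' = y by rewrite /m' (tx x') // mx' ty'.
have m'y : m' y = x' by rewrite /m' ty -mx' mK tx.
have m'y' : m' y' = x by rewrite /m' ty' -mx mK tx.
have m'z z : z \notin [:: x; y; x'; y'] -> m' z = m z.
  rewrite !inE !negb_or => /and4P[zx zy zx' zy'].
  rewrite /m' [t z]tpermD 1?eq_sym // tpermD //.
    by rewrite -mx (inj_eq (can_inj mK)) eq_sym.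
  by rewrite -mx' (inj_eq (can_inj mK)) eq_sym.
have Mm' : matching m'.
  split=> [z|z]; first by rewrite /m' tpermK mK tpermK.
  have [|/m'z-> //] := boolP (z \in [:: x; y; x'; y']).
  by rewrite !inE => /or4P[] /eqP->; rewrite ?m'x ?m'y ?m'x' ?m'y' // eC.
exists m'; split=> //.
exists (tperm x x') => [z|].
  case cz: (col z).
    by rewrite tpermD //; apply: neq.
  have [<-|xz] := eqVneq x z; first by rewrite tpermL mx m'y.
  have [<-|x'z] := eqVneq x' z; first by rewrite tpermR mx' m'y'.
  rewrite tpermD // m'z ?mK // !inE !negb_or -{1}mx -{1}mx'.
  rewrite !(inj_eq (can_inj mK)) ![z == _]eq_sym xz x'z /= andbT.
  by rewrite ![m z == _]eq_sym !neq // (matching_col _ Mm) cz.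
rewrite odd_tperm xx' /arc_parity -big_split /= (bigD1 x) //= (bigD1 x') /=.
  rewrite big1 ?addbF ?mx ?mx' ?m'x ?m'x'.
    by move: odd_sq; case: (d x y); case: (d x' y'); case: (d x y'); case: (d x' y).
  move=> z /andP[/andP[cz zx] zx']; rewrite m'z ?addbb // !inE !negb_or zx zx'.
  by rewrite !neq.
by rewrite cx' eq_sym.
Qed.

Lemma perfect_matching_partner (A : {set V}) M :
    perfect_matching_on e A M ->
  exists m, forall x, x \in A -> [/\ m x \in A, e x (m x) & m (m x) = x].
Proof.
case=> /and3P[/eqP covM tiM _] Me.
(* The default is only met outside [A], where the value is irrelevant. *)
pose m x := odflt x [pick y | e x y && (pblock M x == [set x; y])].
have mP x y : e x y -> [set x; y] \in M -> m x = y.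
  move=> exy xyM; have Bx : pblock M x = [set x; y].
    by rewrite (def_pblock tiM xyM) // set21.
  rewrite /m; case: pickP => [z /andP[exz]|/(_ y)]; last by rewrite exy Bx eqxx.
  rewrite Bx => /eqP E; have: z \in [set x; y] by rewrite E set22.
  rewrite !inE => /orP[/eqP Dz|/eqP//].
  by have:= ecol exz; rewrite Dz; case: (col x).
exists m => x; rewrite -covM => xA.
have BM := pblock_mem xA; have [a [b [eab EB]]] := Me _ BM.
have [eba EB'] : e b a /\ pblock M x = [set b; a] by rewrite eC setUC.
have [xB BA] : x \in pblock M x /\ pblock M x \subset cover M.
  by rewrite mem_pblock xA; split=> //; apply: (bigcup_sup _ BM).
have [mab mba] : m a = b /\ m b = a.
  by split; apply: mP; rewrite // -?EB -?EB'.
have [aA bA] : a \in cover M /\ b \in cover M.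
  by split; apply: (subsetP BA); rewrite EB !inE eqxx ?orbT.
by move: xB; rewrite EB !inE => /orP[]/eqP->; rewrite ?mab ?mba ?mab.
Qed.

Lemma odd_count (T : Type) (a : pred T) (s : seq T) :
  odd (count a s) = \big[addb/false]_(x <- s) a x.
Proof. by elim: s => [|x s IHs]; rewrite ?big_nil // big_cons -IHs /= oddD oddb. Qed.

Lemma same_sign_pfaffian :
    (forall m m', matching m -> matching m' -> same_sign m m') ->
  pfaffian_orientation e d.
Proof.
move=> all_same; split=> // c [/andP[c_gt2 /andP[ec Uc]] [M pmM]] even_c.
have [m0 m0P] := perfect_matching_partner pmM.
have ccol z : z \in c -> col (next c z) = ~~ col z.
  by move=> zc; apply: ecol; apply: next_cycle.
have pcol z : z \in c -> col (prev c z) = ~~ col z.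
  by move=> zc; rewrite (ecol (prev_cycle ec zc)) negbK.
(* On [c], [m false] joins each black vertex to its successor and [m true] joins it to its
   predecessor; off [c] both follow the given matching. *)
pose m b z := if z \in c then if col z (+) b then prev c z else next c z else m0 z.
have Mm b : matching (m b).
  split=> z; rewrite /m; case zc: (z \in c).
  - case cz: (col z (+) b); rewrite (mem_prev, mem_next) zc (pcol, ccol) // addNb cz /=.
      by rewrite next_prev.
    by rewrite prev_next.
  - have [|m0A _ m0K] := m0P z; first by rewrite !inE zc.
    by move: m0A; rewrite !inE => /negPf->.
  - by case: ifP => _; [rewrite eC prev_cycle | rewrite next_cycle].
  - by have [|_ e0 _] := m0P z; first by rewrite !inE zc.
have [k szc] : exists k, size c = k.*2.+2.
  exists (size c)./2.-1; rewrite -doubleS prednK ?half_gt0 1?ltnW //.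
  by rewrite -[LHS]odd_double_half (negPf even_c).
have [p pE odd_p] : exists2 p : {perm V},
    forall z, p z = if col z then z else next c (next c z) & odd_perm p = odd k.
  have [x xc cx] : exists2 x, x \in c & ~~ col x.
    have [y yc] : exists y, y \in c.
      by case: (c) c_gt2 => // a s _; exists a; rewrite mem_head.
    by case cy: (col y); [exists (next c y) | exists y]; rewrite ?mem_next ?ccol ?cy.
  have [i s rot_c] := rot_to xc.
  have [||||p pE podd] := @odd_perm_two_steps _ col k (rot i c).
  - by rewrite size_rot.
  - by rewrite rot_uniq.
  - by rewrite rot_cycle; apply: sub_cycle ec => y z /ecol->.
  - by rewrite rot_c.
  - by exists p => // z; rewrite pE !next_rot.
have [q qE odd_q] := all_same _ _ (Mm false) (Mm true).
(* From a black vertex of [c], [m false] and then [m true] both step forward; off [c] they cancel,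
   and [next c] is the identity. *)
have Dq : q = p.
  apply/permP => z; rewrite qE pE; case cz: (col z) => //; rewrite {2}/m cz /=.
  case zc: (z \in c); first by rewrite /m mem_next zc ccol // cz.
  have [|m0A _ m0K] := m0P z; first by rewrite !inE zc.
  have /negPf zN : m0 z \notin c by rewrite !inE in m0A.
  by rewrite /m zN m0K !next_notin // zc.
have next_c : perm_eq (map (next c) c) c.
  apply: uniq_perm => //; first by rewrite (map_inj_uniq (can_inj (prev_next Uc))).
  move=> z; apply/mapP/idP => [[y yc ->]|zc]; first by rewrite mem_next.
  by exists (prev c z); rewrite ?mem_prev ?next_prev.
have dprev y : y \in c -> d (next c y) y = ~~ d y (next c y).
  by move=> yc; apply/orientationN/next_cycle.
have count_prev : count (fun x => d x (prev c x)) c + forward_arcs d c = size c.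
  rewrite -(seq.permP next_c) count_map addnC.
  rewrite -[RHS](count_predC (fun x => d x (next c x))).
  by congr (_ + _); apply: eq_in_count => y yc /=; rewrite prev_next // dprev.
have count_col : odd (count col c) = ~~ odd k.
  have: count col c + count col c = size c.
    rewrite -[in RHS](count_predC col); congr (_ + _).
    rewrite -(seq.permP next_c) count_map.
    by apply: eq_in_count => y yc /=; rewrite ccol.
  by rewrite addnn szc -doubleS => /double_inj->.
have odd_c : odd (forward_arcs d c).
  pose f z := ~~ col z && (d z (next c z) (+) d z (prev c z)).
  have Dk : odd k = \big[addb/false]_(z <- c) f z.
    rewrite big_uniq //= big_rmcond => [|z zc]; last first.
      by rewrite /f !(next_notin, prev_notin) // addbb andbF.
    rewrite -odd_p -Dq odd_q /arc_parity -big_split /= big_mkcond /=.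
    apply: eq_bigr => z _; rewrite /f /m; case cz: (col z) => //=.
    by case: ifP => // zc; rewrite !(next_notin, prev_notin) ?zc // !addbb.
  (* Shifting by one along [c] turns arcs from black vertices to their predecessors into non-forward
     steps at the other vertices. *)
  have Dprev : \big[addb/false]_(z <- c) (~~ col z && d z (prev c z))
      = \big[addb/false]_(z <- c) (col z && ~~ d z (next c z)).
    rewrite -(perm_big _ next_c) /= big_map; apply: eq_big_seq => z zc.
    by rewrite ccol // negbK prev_next // dprev.
  (* The negation adds 1 for each of the [k.+1] vertices that are not black, so the number of
     forward arcs is odd. *)
  have: odd k = odd (forward_arcs d c) (+) odd (count col c).
    rewrite Dk !odd_count -big_split /=.
    under eq_bigr => z _ do rewrite /f andb_addr.
    rewrite big_split /= Dprev -big_split /=; apply: eq_bigr => z _.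
    by case: (col z); case: (d _ _).
  by rewrite count_col; case: (odd k); case: odd.
rewrite /oddly_oriented odd_c /= /forward_arcs count_rev.
rewrite (eq_count (a2 := fun x => d x (prev c x))) => [|x]; last by rewrite next_rev.
(* The two directions together count the edges of an even cycle, so both counts have the same
   parity. *)
have := congr1 odd count_prev.
by rewrite oddD odd_c (negPf even_c) addbT => /negbFE.
Qed.

End BipartiteMatchings.

(** * The product of the 4-cycle with a tree *)

Section C4Tree.

Lemma I4_ind (P : 'I_4 -> Prop) : P T1 -> P T2 -> P T4 -> P T3 -> forall i, P i.
Proof.
move=> P1 P2 P4 P3 i.
have : i \in [:: T1; T2; T4; T3] by case: i => [[|[|[|[|]]]]].
by rewrite !inE => /or4P[] /eqP->.
Qed.

(** The 4-cycle is complete bipartite between even and odd positions. *)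
Lemma cycle_graph4E (i j : 'I_4) : cycle_graph i j = (odd i != odd j).
Proof. by elim/I4_ind: i; elim/I4_ind: j. Qed.

Lemma C4_arcN (i j : 'I_4) : odd i != odd j -> C4_arc j i = ~~ C4_arc i j.
Proof. by elim/I4_ind: i; elim/I4_ind: j. Qed.

Lemma C4_arc_graph (i j : 'I_4) : C4_arc i j -> odd i != odd j.
Proof. by elim/I4_ind: i; elim/I4_ind: j. Qed.

Lemma mem_T1T4 (i : 'I_4) : (i \in [:: T1; T4]) = ~~ odd i.
Proof. by elim/I4_ind: i. Qed.

(* Exchanges T1 with T2 and T4 with T3. *)
Definition pair4 (i : 'I_4) : 'I_4 := if odd i then ord_pred i else ordS i.

Lemma pair4K : involutive pair4.
Proof. by move=> i; apply/eqP; elim/I4_ind: i. Qed.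

Lemma odd_pair4 i : odd (pair4 i) = ~~ odd i.
Proof. by elim/I4_ind: i. Qed.

(** The positions [i], [j], [pair4 j], [pair4 i] go once round the 4-cycle, which has three arcs
    along one direction and one along the other. *)
Lemma C4_odd (i j : 'I_4) : odd i != odd j -> j != pair4 i ->
  C4_arc i j (+) C4_arc (pair4 j) (pair4 i)
    (+) (C4_arc i (pair4 i) (+) C4_arc (pair4 j) j).
Proof. by elim/I4_ind: i; elim/I4_ind: j. Qed.

Lemma C4_other (i j k : 'I_4) : odd i != odd j -> j != pair4 i ->
  odd k = odd i -> k != i -> k = pair4 j.
Proof.
move=> ij jp ki kNi; apply/eqP; move: ij jp ki kNi.
by elim/I4_ind: i; elim/I4_ind: j; elim/I4_ind: k.
Qed.

Variables (V : finType) (t te : rel V) (c : V -> bool).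
Hypothesis st : simple_graph t.
Hypothesis acyc : forall s : seq V, ~~ is_cycle t s.
Hypothesis tte : is_orientation t te.
Hypothesis tc : forall x y, t x y -> c y = ~~ c x.

Local Notation G := (cartesian (@cycle_graph 4) t).
Local Notation D := (C4_tree_orientation te).

Definition product_colour (z : 'I_4 * V) : bool := odd z.1 (+) c z.2.
Local Notation col := product_colour.

Lemma cartesian_sym : symmetric G.
Proof.
move=> [i x] [j y]; rewrite /cartesian /= !cycle_graph4E (proj1 st).
by rewrite ![_ == i]eq_sym ![_ == x]eq_sym [odd j == _]eq_sym.
Qed.

Lemma cartesian_colour z w : G z w -> col w = ~~ col z.
Proof.
case: z w => [i x] [j y]; rewrite /cartesian /col /= cycle_graph4E.
case/orP=> /andP[/eqP<-]; first by move/tc->; rewrite addbN.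
by case: (odd i); case: (odd j); case: (c x).
Qed.

Lemma C4_tree_is_orientation : is_orientation G D.
Proof.
have [tE teN] := tte; split=> [] [i x] [j y];
  rewrite /cartesian /C4_tree_orientation /= !mem_T1T4.
  rewrite cycle_graph4E; case: (eqVneq i j) => [<-|ij] /=.
    by rewrite !eqxx /= andbF orbF tE; case: (odd i); rewrite // orbC.
  rewrite [y == x]eq_sym; case: eqP => //= _.
  have [oij|/C4_arcN->] := boolP (odd i == odd j); last by rewrite orbN.
  by apply/esym/negP => /orP[]/C4_arc_graph; rewrite ?(eqP oij) eqxx.
case: (eqVneq i j) => [<-|ij] /=; first by case: (odd i) => /= /teN.
by case/andP=> _ a; rewrite negb_and (C4_arcN (C4_arc_graph a)) a orbT.
Qed.

(** Copies at adjacent positions carry converse orientations, so the two tree terms cancel; the two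
    fibre terms traverse parallel arcs in opposite directions and sum to 1. *)
Lemma tree_square u v (i j : 'I_4) : t u v -> odd i != odd j ->
  D (i, u) (i, v) (+) D (j, v) (j, u) (+) (D (i, u) (j, u) (+) D (j, v) (i, v)).
Proof.
move=> tuv oij; have ij : i != j by apply: contraNneq oij => ->.
rewrite /C4_tree_orientation /= !eqxx [j == i]eq_sym (negPf ij) /= !mem_T1T4.
rewrite (C4_arcN oij); case: (odd i) oij; case: (odd j) => //= _;
  by case: (te _ _); case: (C4_arc _ _).
Qed.

Lemma fibre_square (u : V) (i j : 'I_4) : odd i != odd j -> j != pair4 i ->
  D (i, u) (j, u) (+) D (pair4 j, u) (pair4 i, u)
    (+) (D (i, u) (pair4 i, u) (+) D (pair4 j, u) (j, u)).
Proof.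
move=> oij jpi; have/C4_odd/(_ jpi) := oij.
have neq (a b : 'I_4) : odd a != odd b -> (a == b) = false.
  by move=> oab; apply/negP => /eqP Dab; rewrite Dab eqxx in oab.
rewrite /C4_tree_orientation /= !eqxx /= !neq ?odd_pair4 //;
  by case: odd oij; case: odd.
Qed.

(* Each side of a tree edge carries as many vertices of either colour, so the
   matching edges across it are equally divided between the two colours. *)
Lemma matching_crossing m u v (i : 'I_4) :
    matching G m -> t u v -> m (i, u) = (i, v) ->
  exists2 j : 'I_4, odd i != odd j & m (j, u) = (j, v).
Proof.
move=> Mm tuv miu; have [mK em] := Mm.
have [A [uA vA cutA]] := acyclic_edge_cut st acyc tuv.
have mcol z : col (m z) = ~~ col z := cartesian_colour (em z).
pose b := col (i, u).
pose W := [set z | (z.2 \in A) && (col z != b)].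
pose B := [set z | (z.2 \in A) && (col z == b)].
(* Rotating the 4-cycle by one position preserves the side [A] and exchanges the colours. *)
have leBW : #|B| <= #|W|.
  pose f (z : 'I_4 * V) := (ordS z.1, z.2).
  have inj_f : injective f.
    move=> [k x] [l y] [kl ->]; congr (_, _).
    by apply: (can_inj (@ordSK 4)); apply: val_inj.
  rewrite -(card_imset _ inj_f); apply/subset_leq_card/subsetP => _ /imsetP[z zB ->].
  move: zB; rewrite !inE /= => /andP[-> /eqP<-] /=.
  have -> : col (f z) = ~~ col z.
    by case: z => k x; rewrite /col /= -addNb; congr (_ (+) _); elim/I4_ind: k.
  by case: (col z).
have [/existsP[z /andP[zW mzA]] | none] :=
  boolP [exists z, (z \in W) && ((m z).2 \notin A)].
  case: z zW mzA (em z) => j x; case Dm: (m (j, x)) => [k y] /=.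
  rewrite inE /cartesian /= => /andP[xA xb] yA.
  case/orP=> /andP[/eqP Dj]; last by rewrite Dj (negPf yA) in xA.
  move=> txy; have [Dx Dy] := cutA _ _ txy xA yA; subst k x y.
  exists j => //; apply: contraNneq xb => oij.
  by rewrite /b /col /= oij.
(* If no vertex of [W] is matched across the cut, [m] injects [W] into [B] without [(i, u)], whose
   partner lies outside [A]. This contradicts the count above. *)
have : m @: W \subset B :\ (i, u).
  apply/subsetP => _ /imsetP[z zW ->].
  have mzA : (m z).2 \in A.
    by apply: contraNT none => mzA; apply/existsP; exists z; rewrite zW.
  move: zW; rewrite !inE mzA mcol => /andP[zA zb]; apply/andP; split.
    apply: contraNneq vA => mz.
    by have := mK z; rewrite mz miu => Dz; rewrite -Dz in zA.
  by case: (col z) zb; case: (b).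
move/subset_leq_card; rewrite (card_imset _ (can_inj mK)) => leWB.
have iuB : (i, u) \in B by rewrite !inE uA eqxx.
by move: leBW; rewrite (cardsD1 (i, u)) iuB add1n ltnNge leWB.
Qed.

Definition fibre_matching (z : 'I_4 * V) := (pair4 z.1, z.2).

Lemma fibre_matchingP : matching G fibre_matching.
Proof.
split=> [[i x]|[i x]]; rewrite /fibre_matching /= ?pair4K //.
by rewrite /cartesian /= !eqxx cycle_graph4E odd_pair4; case: odd; rewrite orbT.
Qed.

(* An edge between two fibres weighs 2, as replacing a pair of such edges may
   create fibre edges which differ from those of [fibre_matching]. *)
Definition defect (z w : 'I_4 * V) : nat :=
  (w.2 != z.2) + (w != fibre_matching z).

Lemma defectC z w : defect z w = defect w z.
Proof.
rewrite /defect eq_sym; congr (_ + ~~ _).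
by rewrite -(inj_eq (can_inj (proj1 fibre_matchingP))) (proj1 fibre_matchingP) eq_sym.
Qed.

Lemma same_sign_fibre_matching m :
  matching G m -> same_sign D col m fibre_matching.
Proof.
have [n] := ubnP (\sum_z defect z (m z)).
elim: n m => // n IHn m /ltnSE-le_n Mm; have [mK em] := Mm.
have mcol z : col (m z) = ~~ col z := cartesian_colour (em z).
(* The threshold [a] separates the weights of the removed edges from the smaller ones of the new
   edges: 2 for tree edges, 1 for misplaced fibre edges. *)
have flip a x y x' y' : ~~ col x -> x != x' -> m x = y -> m x' = y' ->
    G x y' -> G x' y -> D x y (+) D x' y' (+) (D x y' (+) D x' y) ->
    a <= defect x y -> a <= defect x' y' -> defect x y' < a -> defect x' y < a ->
  same_sign D col m fibre_matching.
- move=> cx xx' mx mx' exy' ex'y odd_sq le1 le2 lt1 lt2.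
  have [m' [Mm' mm' [m'x m'y m'x' m'y'] m'E]] :=
    matching_flip cartesian_sym cartesian_colour Mm cx xx' mx mx' exy' ex'y odd_sq.
  apply: (same_sign_trans cartesian_colour Mm Mm' mm'); apply: IHn => //.
  apply: leq_trans le_n; rewrite (bigD1 x) // [ltnRHS](bigD1 x) //= -addSn.
  rewrite leq_add ?m'x ?mx ?(leq_trans lt1) //; apply: leq_sum => z _.
  have [|/m'E->//] := boolP (z \in [:: x; y; x'; y']).
  have my : m y = x by rewrite -mx mK.
  have my' : m y' = x' by rewrite -mx' mK.
  rewrite !inE => /or4P[] /eqP->.
  + by rewrite m'x mx ltnW // (leq_trans lt1).
  + by rewrite m'y my defectC [defect y x]defectC ltnW // (leq_trans lt2).
  + by rewrite m'x' mx' ltnW // (leq_trans lt2).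
  + by rewrite m'y' my' defectC [defect y' x']defectC ltnW // (leq_trans lt1).
(* A symmetric property of a matching edge can be read from its black end, where a flip has to
   start. *)
have black (P : rel ('I_4 * V)) : symmetric P -> [exists z, P z (m z)] ->
    exists2 z, ~~ col z & P z (m z).
  move=> PC /existsP[z Pz]; case cz: (col z); last by exists z; rewrite ?cz.
  by exists (m z); rewrite ?mcol ?cz // mK PC.
have [/(black (fun z w => w.2 != z.2))[z w|] | no_cross] :=
  boolP [exists z, (m z).2 != z.2].
- by rewrite eq_sym.
- case=> i u; case Dm: (m (i, u)) => [k v] /= cx vu.
  have := em (i, u); rewrite Dm /cartesian /= [u == v]eq_sym (negPf vu) orbF.
  case/andP=> /eqP Dk tuv; subst k.
  have [j oij mj] := matching_crossing Mm tuv Dm.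
  have oji : odd j != odd i by rewrite eq_sym.
  apply: (flip 2 (i, u) (i, v) (j, v) (j, u)) => //.
  + by rewrite xpair_eqE negb_and [u == v]eq_sym vu orbT.
  + by rewrite -mj mK.
  + by rewrite /cartesian /= eqxx cycle_graph4E oij orbT.
  + by rewrite /cartesian /= eqxx cycle_graph4E oji orbT.
  + exact: tree_square.
  + by rewrite /defect /= vu xpair_eqE /= negb_and vu orbT.
  + by rewrite /defect /= eq_sym vu xpair_eqE /= negb_and [u == v]eq_sym vu orbT.
  + by rewrite /defect /= eqxx; case: eqP.
  + by rewrite /defect /= eqxx; case: eqP.
have m2 z : (m z).2 = z.2.
  by apply/eqP; apply: contraNT no_cross => mz; apply/existsP; exists z.
have mE (i : 'I_4) u : exists2 j : 'I_4, odd i != odd j & m (i, u) = (j, u).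
  have := em (i, u); have := m2 (i, u); case: (m _) => j v /= ->.
  rewrite /cartesian /= cycle_graph4E (proj2 st) andbF eqxx /=.
  by exists j.
have [/(black (fun z w => w != fibre_matching z))[z w|] | no_defect] :=
  boolP [exists z, m z != fibre_matching z].
- by rewrite -(inj_eq (can_inj (proj1 fibre_matchingP))) (proj1 fibre_matchingP) eq_sym.
- case=> i u; have [j oij mi] := mE i u; rewrite mi => cx.
  rewrite xpair_eqE /= eqxx andbT => jpi.
  have ipj : i != pair4 j by apply: contraNneq jpi => ->; rewrite pair4K.
  have oji : odd j != odd i by rewrite eq_sym.
  (* In the fibre over [u], the neighbours of position [pair4 j] are [j] and [pair4 i], and [j] is
     already matched to [i]. *)
  have mpj : m (pair4 j, u) = (pair4 i, u).
    have [k ojk mj] := mE (pair4 j) u; rewrite mj; congr (_, _).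
    apply: (C4_other oji ipj).
      by move: ojk; rewrite odd_pair4; case: (odd j); case: (odd k).
    apply: contraNneq ipj => Dk; rewrite Dk -mi in mj.
    by have [->] := can_inj mK mj.
  apply: (flip 1 (i, u) (j, u) (pair4 j, u) (pair4 i, u)) => //.
  + by rewrite xpair_eqE negb_and ipj.
  + by rewrite /cartesian /= eqxx cycle_graph4E odd_pair4; case: (odd _); rewrite orbT.
  + by rewrite /cartesian /= eqxx cycle_graph4E odd_pair4; case: (odd _); rewrite orbT.
  + exact: fibre_square.
  + by rewrite /defect /fibre_matching xpair_eqE /= eqxx andbT jpi.
  + by rewrite /defect /fibre_matching xpair_eqE /= eqxx andbT pair4K eq_sym jpi.
  + by rewrite /defect /= !eqxx.
  + by rewrite /defect /fibre_matching /= pair4K !eqxx.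
apply: eq_same_sign Mm _ => z; apply/eqP.
by apply: contraNT no_defect => mz; apply/existsP; exists z.
Qed.

End C4Tree.

Theorem theorem6 (V : finType) (t te : rel V)
    (ht : is_tree t) (hte : is_orientation t te) :
  pfaffian_orientation (cartesian (@cycle_graph 4) t) (C4_tree_orientation te).
Proof.
have [st _ _ acyc] := ht; have [c tc] := acyclic_two_colouring st acyc.
have Gcol := cartesian_colour tc.
apply: (same_sign_pfaffian (cartesian_sym st) Gcol (C4_tree_is_orientation hte)).
move=> m m' Mm Mm'; have fib := same_sign_fibre_matching te st acyc tc.
apply: (same_sign_trans Gcol Mm (fibre_matchingP t) (fib _ Mm)).
by apply: (same_sign_sym Gcol Mm' (fibre_matchingP t)); apply: fib.
Qed.
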